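(* Let $(X, G, U)$ be a topological dynamical system, where $X$ is a nonempty compact metrizable space and $G$ is a countable discrete amenable group. For a nonempty finite set $F \subseteq G$ and $f \in C(X)$, write $\operatorname{Avg}_F f = \frac{1}{|F|} \sum_{g \in F} f \circ U_g$. Then the following conditions are equivalent. (i) $(X, G, U)$ is uniquely ergodic. (ii) There exist a left Følner sequence $(F_k)_{k=1}^\infty$ for $G$ and a Borel probability measure $\mu$ on $X$ such that for all $f \in C(X)$, the sequence $(\operatorname{Avg}_{F_k} f)_{k=1}^\infty$ converges uniformly to $\int f \, \mathrm{d}\mu$. (iii) There exist a left Følner sequence $(F_k)_{k=1}^\infty$ for $G$ and a Borel probability measure $\mu$ on $X$ such that for all $f \in C(X)$, the sequence $(\operatorname{Avg}_{F_k} f)_{k=1}^\infty$ converges pointwise to $\int f \, \mathrm{d}\mu$. (iv) There exists a Borel probability measure $\mu$ on $X$ such that for every right Følner sequence $(F_k)_{k=1}^\infty$ for $G$ and every $f \in C(X)$, the sequence $(\operatorname{Avg}_{F_k} f)_{k=1}^\infty$ converges uniformly to $\int f \, \mathrm{d}\mu$. (v) There exists a Borel probability measure $\mu$ on $X$ such that for every right Følner sequence $(F_k)_{k=1}^\infty$ for $G$ and every $f \in C(X)$, the sequence $(\operatorname{Avg}_{F_k} f)_{k=1}^\infty$ converges pointwise to $\int f \, \mathrm{d}\mu$.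
   Context: $C(X)$ is the C*-algebra of continuous complex-valued functions on $X$. A topological dynamical system $(X, G, U)$ consists of $X$, $G$ and homeomorphisms $U_g : X \to X$ ($g \in G$) such that $\Theta_g : f \mapsto f \circ U_g$ defines a group action $\Theta : G \to \operatorname{Aut}(C(X))$, i.e. $\Theta_{gh} = \Theta_g \Theta_h$; equivalently $U_{gh} = U_h \circ U_g$ for all $g, h \in G$. It is uniquely ergodic if there is exactly one Borel probability measure on $X$ that is invariant under all $U_g$. A left (resp. right) Følner sequence for $G$ is a sequence $(F_k)_{k=1}^\infty$ of nonempty finite subsets of $G$ such that $|gF_k \Delta F_k|/|F_k| \to 0$ (resp. $|F_k g \Delta F_k|/|F_k| \to 0$) as $k \to \infty$ for every $g \in G$. *)

(* Defs.v *)
From HB Require Import structures.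
From mathcomp Require Import all_boot all_order all_algebra.
From mathcomp Require Import finmap complex.
From mathcomp Require Import all_classical all_reals all_analysis.

Set Implicit Arguments.
Unset Strict Implicit.
Unset Printing Implicit Defensive.

Import Order.TTheory GRing.Theory Num.Theory.
Import numFieldNormedType.Exports.

Local Open Scope classical_set_scope.
Local Open Scope ring_scope.

Definition homeomorphism (X Y : topologicalType) (f : X -> Y) : Prop :=
  exists f' : Y -> X,
    [/\ continuous f, continuous f', cancel f f' & cancel f' f].

Definition metrizable (R : realType) (X : topologicalType) : Prop :=
  exists (M : metricType R) (h : X -> M), homeomorphism h.

Notation borel X := (g_sigma_algebraType (@open X)).

(* Amenability of a discrete group: existence of a left-invariant, finitely
   additive probability measure defined on all subsets. *)
Definition amenable (R : realType) (G : groupType) : Prop :=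
  exists m : set G -> R,
    [/\ forall A, 0 <= m A,
        m [set: G] = 1,
        forall A B, A `&` B = set0 -> m (A `|` B) = m A + m B &
        forall g A, m [set (g * x)%g | x in A] = m A].

Definition fset_symdiff (T : choiceType) (A B : {fset T}) : {fset T} :=
  ((A `\` B) `|` (B `\` A))%fset.

Definition left_Folner (R : realType) (G : groupType)
    (F : nat -> {fset G}) : Prop :=
  (forall k, F k != fset0) /\
  forall g : G,
    (#|` fset_symdiff [fset (g * x)%g | x in F k]%fset (F k)|%:R
       / #|` F k|%:R : R) @[k --> \oo] --> (0 : R).

Definition right_Folner (R : realType) (G : groupType)
    (F : nat -> {fset G}) : Prop :=
  (forall k, F k != fset0) /\
  forall g : G,
    (#|` fset_symdiff [fset (x * g)%g | x in F k]%fset (F k)|%:R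
       / #|` F k|%:R : R) @[k --> \oo] --> (0 : R).

(* The composition order makes f |-> f \o U g a left action on functions. *)
Definition dynamical_system (X : topologicalType) (G : groupType)
    (U : G -> X -> X) : Prop :=
  (forall g, homeomorphism (U g)) /\
  (forall g h, U (g * h)%g = U h \o U g).

Definition invariant_measure (R : realType) (X : ptopologicalType)
    (G : groupType) (U : G -> X -> X) (mu : probability (borel X) R) : Prop :=
  forall g (A : set (borel X)), measurable A -> mu (U g @^-1` A) = mu A.

(* Uniqueness is agreement on Borel sets: a [probability] is a function on all
   subsets, whose values off the sigma-algebra carry no meaning, so Leibniz
   equality would be too strong. *)
Definition uniquely_ergodic (R : realType) (X : ptopologicalType)
    (G : groupType) (U : G -> X -> X) : Prop :=
  exists2 mu : probability (borel X) R, invariant_measure U mu &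
    forall nu : probability (borel X) R, invariant_measure U nu ->
      forall A : set (borel X), measurable A -> nu A = mu A.

(* R[i] carries its usual topology through its regular-module copy R[i]^o. *)
Definition Avg (R : realType) (X : topologicalType) (G : groupType)
    (U : G -> X -> X) (F : {fset G}) (f : X -> R[i]^o) : X -> R[i]^o :=
  fun x => (#|` F|%:R : R[i])^-1 * \sum_(g <- F) f (U g x).

Definition cintegral (R : realType) (X : ptopologicalType)
    (mu : probability (borel X) R) (f : X -> R[i]^o) : R[i]^o :=
  Complex (\int[mu]_x complex.Re (f x)) (\int[mu]_x complex.Im (f x)).

Definition Avg_cvg_uniform (R : realType) (X : ptopologicalType)
    (G : groupType) (U : G -> X -> X) (F : nat -> {fset G})
    (mu : probability (borel X) R) (f : X -> R[i]^o) : Prop :=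
  {uniform, (fun k => Avg U (F k) f) @ \oo --> (cst (cintegral mu f) : X -> R[i]^o)}.

Definition Avg_cvg_pointwise (R : realType) (X : ptopologicalType)
    (G : groupType) (U : G -> X -> X) (F : nat -> {fset G})
    (mu : probability (borel X) R) (f : X -> R[i]^o) : Prop :=
  forall x, Avg U (F k) f x @[k --> \oo] --> cintegral mu f.

(* Main.v *)
(**
Given a right Folner sequence (F_k) and points x_k,
any ultrafilter limit of f |-> Avg_{F_k} f (x_k) is a G-invariant mean on C(X),
hence an invariant probability measure; if that measure is forced to be mu, the
averages must converge uniformly to the integral against mu. Conversely, if
Avg_{F_k} f converges pointwise to the constant (int f dmu), integrating against
an invariant nu gives int f dnu = int f dmu, whatever the sets F_k are. What
remains is a Folner sequence that is left and right Folner at once.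

The measure representing a mean L on functions on X is obtained without the
Riesz theorem: a continuous surjection p from the Cantor space onto X has a
(discontinuous) section s, and C |-> L(1_C o s) is finitely additive on clopen
sets, hence sigma-additive by compactness; its extension is pushed forward
along p.

Left almost invariant finite sets come from the invariant mean: if every finite
F satisfied |K F| >= (1 + 1/n) |F|, then |K^n F| >= 2 |F| for all F, and the
marriage theorem would give a paradoxical decomposition of G. If A is left
almost invariant, then A^-1 is right almost invariant, the convolution of their
indicators is almost invariant on both sides, and so is one of its level sets.
*)

Require Import Defs.
From HB Require Import structures.
From mathcomp Require Import all_boot all_order all_algebra.
From mathcomp Require Import finmap complex.
From mathcomp Require Import all_classical all_reals all_analysis.
From mathcomp Require Import measurable_realfun.
From mathcomp Require Import zify lra.

Set Implicit Arguments.
Unset Strict Implicit.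
Unset Printing Implicit Defensive.

Import Order.TTheory GRing.Theory Num.Theory.
Import numFieldNormedType.Exports.

(** * The marriage theorem *)

Section marriage.
Context {T V : choiceType}.
Implicit Types (N M : T -> {fset V}) (S : {fset T}).
Local Open Scope fset_scope.

Definition nbrs N S : {fset V} := \bigcup_(x <- S) N x.

Definition hall N := forall S, (#|` S| <= #|` nbrs N S|)%N.

Lemma nbrsP N S v : reflect (exists2 x, x \in S & v \in N x) (v \in nbrs N S).
Proof.
by apply: (iffP (bigfcupP _ _ _ _)) => [[x /andP[xS _] vN]|[x xS vN]]; exists x;
  rewrite // xS.
Qed.

Lemma nbrsS N M S : (forall x, x \in S -> N x `<=` M x) ->
  nbrs N S `<=` nbrs M S.
Proof.
move=> NM; apply/fsubsetP => v /nbrsP[x xS vN]; apply/nbrsP; exists x => //.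
exact: (fsubsetP (NM _ xS)).
Qed.

(** Zorn's lemma for reverse inclusion. The value sets are finite, so at each point a chain has a
    smallest member, and these pointwise smallest values form a lower bound of the chain. *)
Lemma hall_minimal N : hall N -> exists M,
  [/\ forall x, M x `<=` N x, hall M &
    forall M', hall M' -> (forall x, M' x `<=` M x) -> forall x, M x `<=` M' x].
Proof.
move=> hN; pose P := {M | hall M /\ forall x, M x `<=` N x}.
have sub_refl : forall x, N x `<=` N x by [].
pose R (s t : P) := `[< forall x, sval t x `<=` sval s x >].
have [|r s t /asboolP rs /asboolP st|A Atot|M Mmax] :=
    @ZL_preorder P (exist _ N (conj hN sub_refl)) R.
- by move=> t; apply/asboolP.
- by apply/asboolP => x; exact: fsubset_trans (st x) (rs x).
- have [[M0 AM0]|A0] := pselect (exists M : P, A M); last first.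
    by exists (exist _ N (conj hN sub_refl)) => s As; case: A0; exists s.
  (* By comparability, a member of least cardinality at [x] is included at [x] in every other
     member. *)
  have small x : exists2 M : P, A M & forall M' : P, A M' -> sval M x `<=` sval M' x.
    have ex : exists n, `[< exists2 M : P, A M & #|` sval M x| = n >].
      by exists #|` sval M0 x|; apply/asboolP; exists M0.
    case: (ex_minnP ex) => n /asboolP[M AM Mn] nmin; exists M => // M' AM'.
    have [/asboolP MM'|/asboolP //] := Atot _ _ AM AM'.
    have /eqP <- // : sval M' x == sval M x.
    by rewrite eqEfcard MM' Mn nmin//; apply/asboolP; exists M'.
  pose L x := sval (projT1 (cid2 (small x))) x.
  have Lmin x (M : P) : A M -> L x `<=` sval M x.
    by rewrite /L; case: cid2 => M' /= AM' + AM; exact.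
  have hL : hall L.
    move=> S.
    (* Hall's condition at [S] involves finitely many points, so a single member of the chain lies
       below [L] on all of [S]. *)
    have [M AM ML] : exists2 M : P, A M & forall x, x \in S -> sval M x `<=` L x.
      have : forall s : seq T, exists2 M : P, A M &
          forall x, x \in s -> sval M x `<=` L x.
        elim=> [|x s [M AM MLs]]; first by exists M0.
        rewrite /L; case Dx: (cid2 (small x)) => [M' AM' M'min] /=.
        have M'x : sval M' x = L x by rewrite /L Dx.
        have [/asboolP MM'|/asboolP M'M] := Atot _ _ AM AM'.
          exists M' => // y; rewrite inE => /predU1P[->|ys]; first by rewrite M'x.
          exact: fsubset_trans (MM' y) (MLs y ys).
        exists M => // y; rewrite inE => /predU1P[->|ys]; last exact: MLs.
        by rewrite -/(L x) -M'x; exact: M'M.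
      exact.
    by have [hM _] := svalP M; rewrite (leq_trans (hM S))// fsubset_leq_card// nbrsS.
  have LN x : L x `<=` N x.
    by have [_ MN] := svalP M0; exact: fsubset_trans (Lmin x _ AM0) (MN x).
  exists (exist _ L (conj hL LN)) => M AM; apply/asboolP => x; exact: Lmin.
- have [hM MN] := svalP M; exists (sval M); split => // M' hM' M'M.
  have M'N x : M' x `<=` N x by exact: fsubset_trans (M'M x) (MN x).
  suff /asboolP : R (exist _ M' (conj hM' M'N)) M by [].
  exact/Mmax/asboolP.
Qed.

(* Rado: deleting either of two candidates [a], [b] for [x] would break Hall's
   condition at some [Sa], [Sb]; submodularity of [#|` nbrs _ _|] forbids this. *)
Theorem marriage N : hall N ->
  exists2 f : T -> V, injective f & forall x, f x \in N x.
Proof.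
move=> /hall_minimal[M [MN hM Mmin]].
have del x a : a \in M x -> exists2 S : {fset T}, x \notin S &
    (#|` nbrs M S `|` (M x `\ a)| <= #|` S|)%N.
  move=> aM; pose M' y := if y == x then M x `\ a else M y.
  have M'M y : M' y `<=` M y.
    by rewrite /M'; case: eqP => // ->; exact: fsubD1set.
  have [hM'|] := pselect (hall M').
    have := fsubsetP (Mmin _ hM' M'M x) _ aM.
    by rewrite /M' eqxx !inE eqxx.
  move=> /existsNP[S /negP]; rewrite -ltnNge => ltS.
  have xS : x \in S.
    apply: contraLR ltS => xS; rewrite -leqNgt (leq_trans (hM S))//.
    apply/fsubset_leq_card/nbrsS => y yS.
    by rewrite /M'; case: eqP => // yx; rewrite -yx yS in xS.
  exists (S `\ x); first by rewrite !inE eqxx.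
  rewrite -ltnS; suff: (#|` nbrs M (S `\ x) `|` M x `\ a| <= #|` nbrs M' S|)%N.
    move=> le1; rewrite (leq_ltn_trans le1)// (leq_trans ltS)//.
    by rewrite (cardfsD1 x S) xS.
  apply: fsubset_leq_card; apply/fsubsetP => v /fsetUP[/nbrsP[y]|vM].
    rewrite !inE => /andP[yx yS] vy; apply/nbrsP; exists y => //.
    by rewrite /M' (negbTE yx).
  by apply/nbrsP; exists x => //; rewrite /M' eqxx.
have M1 x : exists a, M x = [fset a].
  have /cardfs1P// : #|` M x| == 1%N.
  rewrite eqn_leq; apply/andP; split; last first.
    have := hM [fset x]; rewrite cardfs1 => /leq_trans; apply.
    by apply: fsubset_leq_card; apply/fsubsetP => v /nbrsP[y /fset1P ->].
  rewrite leqNgt; apply/negP => /[dup] /ltnW.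
  rewrite cardfs_gt0 => /fset0Pn[a aM].
  rewrite (cardfsD1 a) aM add1n ltnS cardfs_gt0 => /fset0Pn[b].
  rewrite !inE => /andP[ba bM].
  have [Sa xSa lea] := del x a aM; have [Sb xSb leb] := del x b bM.
  set P := _ `|` _ in lea; set Q := _ `|` _ in leb.
  (* Since [a] and [b] differ, [P] and [Q] together recover all of [M x], so Hall's condition
     applies to the union of [Sa], [Sb] and the point [x]. This gains one over what [lea] and [leb]
     allow. *)
  have le1 : (#|` Sa `|` Sb|.+1 <= #|` P `|` Q|)%N.
    have := hM (x |` (Sa `|` Sb)); rewrite cardfsU1 !inE (negbTE xSa) (negbTE xSb).
    move=> /leq_trans; apply; apply: fsubset_leq_card.
    apply/fsubsetP => v /nbrsP[y]; rewrite !inE => /orP[/eqP->|/orP[ySa|ySb]] vy.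
    + rewrite vy !andbT; case: (eqVneq v a) => [->|_]; last by rewrite !orbT.
      by rewrite (eq_sym a) ba !orbT.
    + by have -> : v \in nbrs M Sa by apply/nbrsP; exists y.
    + by have -> : v \in nbrs M Sb by [apply/nbrsP; exists y]; rewrite orbT.
  have le2 : (#|` Sa `&` Sb| <= #|` P `&` Q|)%N.
    apply: (leq_trans (hM _)); apply: fsubset_leq_card.
    apply/fsubsetP => v /nbrsP[y]; rewrite !inE => /andP[ySa ySb] vy.
    have -> : v \in nbrs M Sa by apply/nbrsP; exists y.
    by have -> : v \in nbrs M Sb by apply/nbrsP; exists y.
  have := cardfsUI P Q; have := cardfsUI Sa Sb; lia.
pose f x := projT1 (cid (M1 x)).
have Mf x : M x = [fset f x] by rewrite /f; case: cid.
exists f => [x y fxy|x]; last by apply: (fsubsetP (MN x)); rewrite Mf inE.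
apply/eqP; rewrite -[_ == _]negbK; apply/negP => xy.
have := hM [fset x; y]; rewrite cardfs2 xy leqNgt => /negP; apply.
rewrite ltnS -[leqRHS]/1%N -(cardfs1 (f x)); apply: fsubset_leq_card.
by apply/fsubsetP => v /nbrsP[z /fset2P[->|->]]; rewrite Mf// -fxy.
Qed.

End marriage.

(** * Folner sequences *)

(** For injective [s] the number of these points is half that of the symmetric difference of [F] and
    its image; counting them keeps the estimates within the natural numbers. *)
Definition escape (T : choiceType) (s : T -> T) (F : {fset T}) : {fset T} :=
  [fset y in F | s y \notin F]%fset.

Section product_sets.
Context {G : groupType}.
Implicit Types A F : {fset G}.
Local Open Scope fset_scope.

Definition prodfs A F : {fset G} := [fset (a * x)%g | a in A, x in F].

Lemma prodfsP A F y :
  reflect (exists2 a, a \in A & exists2 x, x \in F & y = (a * x)%g)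
    (y \in prodfs A F).
Proof.
apply: (iffP (imfset2P _ _ _ _ _)) => /= -[a aA [x xF ->]]; exists a => //;
  by exists x.
Qed.

Lemma prodfsA A B F : prodfs A (prodfs B F) = prodfs (prodfs A B) F.
Proof.
apply/fsetP => y; apply/prodfsP/prodfsP.
- move=> [a aA [_ /prodfsP[b bB [x xF ->]] ->]]; exists (a * b)%g.
    by apply/prodfsP; exists a => //; exists b.
  by exists x; rewrite // mulgA.
- move=> [_ /prodfsP[a aA [b bB ->]] [x xF ->]]; exists a => //.
  exists (b * x)%g; last by rewrite mulgA.
  by apply/prodfsP; exists b => //; exists x.
Qed.

Lemma prodfs1 F : prodfs [fset 1%g] F = F.
Proof.
apply/fsetP => y; apply/prodfsP/idP => [[_ /fset1P-> [x xF ->]]|yF].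
  by rewrite mul1g.
by exists 1%g; rewrite ?inE//; exists y; rewrite ?mul1g.
Qed.

End product_sets.

Section finitely_additive.
Local Open Scope classical_set_scope.
Local Open Scope ring_scope.
Context {R : realType} {T : Type}.
Implicit Types m : set T -> R.

Definition finitely_additive m :=
  forall A B, A `&` B = set0 -> m (A `|` B) = m A + m B.

Lemma finitely_additive0 m : finitely_additive m -> m set0 = 0.
Proof. by move=> mU; have := mU _ _ (setIid set0); rewrite setU0; lra. Qed.

Lemma finitely_additive_bigsetU m (I : choiceType) (s : seq I) (B : I -> set T) :
    finitely_additive m -> uniq s -> (forall i j x, B i x -> B j x -> i = j) ->
  m (\big[setU/set0]_(i <- s) B i) = \sum_(i <- s) m (B i).
Proof.
move=> madd + Bdisj.
elim: s => [|i s IH] /=; first by rewrite !big_nil finitely_additive0.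
move=> /andP[si us]; rewrite !big_cons madd ?IH//.
apply/seteqP; split => // x [Bx]; rewrite -bigcup_seq => -[j /= js Bjx].
by move: si; rewrite (Bdisj _ _ _ Bx Bjx) js.
Qed.

End finitely_additive.

(** * Left almost invariant sets from an invariant mean *)

Section amenable_almost_invariant.
Context {R : realType} {G : groupType}.
Local Open Scope fset_scope.
Local Open Scope ring_scope.
Local Open Scope classical_set_scope.

(** Cutting [G] according to the translation that [f] uses gives finitely many disjoint pieces;
    invariance of [m] preserves the content of each, and injectivity keeps their images disjoint. *)
Lemma content_range_piecewise_translation (m : set G -> R) (P : {fset G})
    (f : G -> G) :
    m [set: G] = 1 -> finitely_additive m ->
    (forall g A, m [set (g * x)%g | x in A] = m A) ->
    injective f -> (forall x, f x \in [fset (p * x)%g | p in P]%fset) ->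
  m (range f) = 1.
Proof.
move=> m1 madd minv finj fP.
pose A (p : G) := [set x | f x = (p * x)%g].
have rangeE : range f = \big[setU/set0]_(p <- P) [set (p * x)%g | x in A p].
  rewrite -bigcup_seq; apply/seteqP; split => [_ [x _ <-]|_ [p pP [x Ax <-]]].
    have /imfsetP[/= p pP fx] := fP x.
    by exists p => //; exists x => //; rewrite fx.
  by exists x.
have TE : [set: G] = \big[setU/set0]_(p <- P) A p.
  rewrite -bigcup_seq; apply/seteqP; split => // x _.
  by have /imfsetP[/= p pP fx] := fP x; exists p.
rewrite rangeE finitely_additive_bigsetU ?fset_uniq//; last first.
  move=> p q _ [x Ax <-] [y Ay qy]; have /finj yx : f y = f x by rewrite Ax Ay.
  by move: qy; rewrite yx => /mulIg.
under eq_bigr do rewrite minv.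
rewrite -finitely_additive_bigsetU ?fset_uniq// -?TE//.
by move=> p q x; rewrite /A /= => -> /mulIg.
Qed.

(** If all finite sets doubled, Hall's condition would match two copies of [G] into [G], giving two
    disjoint subsets of content 1 within a total mass of 1. *)
Lemma amenable_not_doubling (P : {fset G}) : amenable R G ->
  exists F : {fset G}, (#|` prodfs P F| < 2 * #|` F|)%N.
Proof.
move=> [m [m0 m1 madd minv]]; apply: contrapT => /forallNP nP.
pose N (xb : G * bool) := [fset (p * xb.1)%g | p in P]%fset.
have hN : hall N.
  move=> S; pose S1 := [fset xb.1 | xb in S]%fset.
  have S2 : (#|` S| <= 2 * #|` S1|)%N.
    have -> : (2 * #|`S1| = #|`S1| + #|`S1|)%N by rewrite mul2n addnn.
    apply: (@leq_trans
      #|` [fset (x, true) | x in S1] `|` [fset (x, false) | x in S1]|%fset).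
      apply/fsubset_leq_card/fsubsetP => -[x b] xS; apply/fsetUP.
      have xS1 : x \in S1 by apply/imfsetP; exists (x, b).
      by case: b {xS}; [left|right]; apply/imfsetP; exists x.
    by rewrite (leq_trans (fsubset_leq_card (fsubset_refl _)))// cardfsU
         (leq_trans (leq_subr _ _))// leq_add// leq_imfset_card.
  have /negP := nP S1; rewrite -leqNgt => /(leq_trans S2)/leq_trans; apply.
  apply/fsubset_leq_card/fsubsetP => _ /prodfsP[p pP [x /imfsetP[[/= y b] xS ->] ->]].
  by apply/nbrsP; exists (y, b) => //; apply/imfsetP; exists p.
have [f finj fN] := marriage hN.
have r1 b : m (range (fun x => f (x, b))) = 1.
  apply: (@content_range_piecewise_translation m P) => [|||x y /finj[]|x];
    rewrite ?fN//; exact: (fN (x, b)).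
have : m (range (fun x => f (x, true)) `|` range (fun x => f (x, false))) = 1 + 1.
  rewrite madd ?r1//; apply/seteqP; split => // _ [[x _ <-] [y _ /finj]].
  by case.
set U := _ `|` _ => mU.
have : m (U `|` ~` U) = m U + m (~` U) by apply: madd; rewrite setICr.
by rewrite setUCr m1 mU; have := m0 (~` U); lra.
Qed.

(** If no set worked, multiplication by [K] with the unit adjoined would enlarge every finite set by
    a factor of at least (n+1)/n, and multiplication by the n-th power would double every set. *)
Lemma amenable_left_almost_invariant (K : {fset G}) (n : nat) : amenable R G ->
  exists2 F : {fset G}, F != fset0 &
    forall k, k \in K -> (n * #|` escape (fun x => k * x)%g F| <= #|` F|)%N.
Proof.
move=> amen; apply: contrapT => noF.
have grow1 (F : {fset G}) : (n.+1 * #|` F| <= n * #|` prodfs (1%g |` K)%fset F|)%N.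
  have [->|F0] := eqVneq F fset0; first by rewrite cardfs0 muln0.
  have [k kK ltk] : exists2 k, k \in K &
      (#|` F| < n * #|` escape (fun x => k * x)%g F|)%N.
    apply: contrapT => nok; apply: noF; exists F => // k kK.
    by rewrite leqNgt; apply/negP => ltk; apply: nok; exists k.
  rewrite mulSn; set E := escape _ _ in ltk.
  (* The translates by [k] of the escaping points are new: they lie outside [F]. *)
  have : (#|` F| + #|` E| <= #|` prodfs (1%g |` K)%fset F|)%N.
    have <- : #|` [fset (k * x)%g | x in E]%fset| = #|` E|.
      by rewrite card_imfset//; exact: mulgI.
    rewrite -cardfsUI [X in (_ + X)%N](_ : _ = 0%N).
      rewrite addn0; apply/fsubset_leq_card/fsubsetP => x /fsetUP[xF|].
        by apply/prodfsP; exists 1%g; rewrite ?fset1U1//; exists x; rewrite ?mul1g.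
      move=> /imfsetP[/= y]; rewrite !inE => /andP[yF _] ->.
      by apply/prodfsP; exists k; [rewrite !inE kK orbT|exists y].
    apply/eqP; rewrite cardfs_eq0; apply/eqP/fsetP => x; rewrite !inE.
    apply/negP => /andP[xF /imfsetP[/= y]]; rewrite !inE => /andP[_ /[swap] <-].
    by rewrite xF.
  by nia.
pose P j := iter j (prodfs (1%g |` K)%fset) [fset 1%g]%fset.
have grow j (F : {fset G}) : (n.+1 ^ j * #|` F| <= n ^ j * #|` prodfs (P j) F|)%N.
  elim: j => [|j IH]; first by rewrite prodfs1.
  rewrite /P iterS -/(P j) -prodfsA !expnS.
  by have := grow1 (prodfs (P j) F); nia.
(* For [n = 0] the required inequality is trivial and a singleton would do. *)
have n0 : (0 < n)%N.
  case: n noF {grow1 P grow} => // -[]; exists [fset 1%g]%fset => //.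
  by rewrite -cardfs_gt0 cardfs1.
(* Bernoulli's inequality with denominators cleared; at [j = n] it says that (1 + 1/n)^n is at least
   2. *)
have bern j : ((n + j) * n ^ j <= n * n.+1 ^ j)%N.
  by elim: j => [|j IH]; rewrite ?addn0// !expnS; nia.
have [F ltF] := amenable_not_doubling (P n) amen.
have := grow n F; have := bern n.
by have : (0 < n ^ n)%N by [rewrite expn_gt0 n0]; nia.
Qed.

End amenable_almost_invariant.

(** * Escaping points and superlevel sets of integer weights *)

Section escape_theory.
Context {T : choiceType}.
Local Open Scope fset_scope.
Local Open Scope nat_scope.

Lemma card_fset_filter (S : {fset T}) (p : pred T) :
  #|` [fset x in S | p x]| = \sum_(x <- S) p x.
Proof.
by rewrite card_fset_sum1 big_fset big_mkcond; apply: eq_bigr => x _; case: (p x).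
Qed.

Lemma card_escape_imfset (f s r : T -> T) (A : {fset T}) : injective f ->
    (forall x, s (f x) = f (r x)) ->
  #|` escape s (f @` A)| = #|` escape r A|.
Proof.
move=> finj sf.
have -> : escape s (f @` A) = f @` escape r A.
  apply/fsetP => y; apply/idP/imfsetP => /=.
    rewrite !inE => /andP[/imfsetP[/= x xA ->]]; rewrite sf mem_imfset//= => rx.
    by exists x; rewrite // !inE xA.
  move=> [x]; rewrite !inE => /andP[xA rx] ->.
  by rewrite sf !mem_imfset//= xA.
by rewrite card_imfset.
Qed.

(** The escaping points map onto the part of the image outside [A]; the other part of the symmetric
    difference has the same size, because the image is as large as [A]. *)
Lemma card_symdiff_imfset (f : T -> T) (A : {fset T}) : injective f ->
  #|` fset_symdiff (f @` A) A| <= 2 * #|` escape f A|.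
Proof.
move=> finj.
have DE : f @` A `\` A = f @` escape f A.
  apply/fsetP => y; apply/fsetDP/imfsetP => /=.
    by move=> [/imfsetP[/= x xA ->] fxA]; exists x; rewrite // !inE xA.
  by move=> [x]; rewrite !inE => /andP[xA fxA] ->; rewrite mem_imfset//= xA.
have cE : #|` f @` A `\` A| = #|` escape f A| by rewrite DE card_imfset.
have cA : #|` f @` A| = #|` A| by rewrite card_imfset.
have := cardfsD (f @` A) A; have := cardfsD A (f @` A).
rewrite [A `&` _]fsetIC /fset_symdiff cardfsU; lia.
Qed.

Variables (w : T -> nat) (S : {fset T}) (N : nat).
Hypotheses (wS : forall x, 0 < w x -> x \in S) (wN : forall x, w x <= N).

(** The set where [w] exceeds [t]; intersecting with [S], which contains the support, presents it as
    a finite set. *)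
Definition layer t : {fset T} := [fset x in S | t < w x].

Let mem_layer t x : (x \in layer t) = (t < w x).
Proof.
rewrite !inE; apply: andb_idl => /(leq_ltn_trans (leq0n t)); exact: wS.
Qed.

Let sum_ltn k : k <= N -> \sum_(t < N) (t < k) = k.
Proof.
move=> kN; rewrite -(big_mkord xpredT (fun t => nat_of_bool (t < k))).
rewrite (@big_cat_nat _ _ _ k)//= big_nat (eq_bigr (fun=> 1)) => [|t /andP[_ ->]//].
rewrite -big_nat sum_nat_const_nat subn0 muln1 big_nat big1 ?addn0//.
by move=> t /andP[kt _]; rewrite ltnNge kt.
Qed.

Lemma sum_layer : \sum_(t < N) #|` layer t| = \sum_(x <- S) w x.
Proof.
under [LHS]eq_bigr do rewrite card_fset_filter.
by rewrite exchange_big/=; apply: eq_bigr => x _; rewrite sum_ltn.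
Qed.


(** A coarea formula: [x] escapes from layer [t] exactly when [w (s x) <= t < w x]. The subtraction
    is truncated, so only decreases of [w] count. *)
Lemma sum_escape_layer (s : T -> T) :
  \sum_(t < N) #|` escape s (layer t)| = \sum_(x <- S) (w x - w (s x)).
Proof.
have E t : #|` escape s (layer t)| =
    \sum_(x <- S) ((t < w x) && (w (s x) <= t)).
  rewrite -card_fset_filter; congr #|` _|; apply/fsetP => x.
  by have := mem_layer t (s x); rewrite !inE => ->; rewrite -leqNgt andbA.
under [LHS] eq_bigr do rewrite E.
rewrite exchange_big/=; apply: eq_bigr => x _.
have := sum_ltn (wN x).
have := sum_ltn (leq_trans (geq_minl (w x) (w (s x))) (wN x)).
set u := \sum_(t < N) (_ && _) => u1 u2.
(* The levels below [w x] split into those counted by [u] and those below the minimum. *)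
suff : u + minn (w x) (w (s x)) = w x by rewrite /minn; case: ltnP; lia.
rewrite -{2}u2 -{1}u1 -big_split/=; apply: eq_bigr => t _.
by rewrite leq_min [w (s x) <= t]leqNgt; case: (t < w x); case: (t < w (s x)).
Qed.

Variables (I : choiceType) (B : {fset I}) (A : I -> {fset T}).
Hypothesis wE : forall x, w x = \sum_(i <- B) (x \in A i).

(** The decrease of a sum of indicators is at most the sum of their decreases. *)
Lemma sum_escape_layer_le (s : T -> T) :
  \sum_(t < N) #|` escape s (layer t)| <= \sum_(i <- B) #|` escape s (A i)|.
Proof.
rewrite sum_escape_layer.
apply: (@leq_trans (\sum_(x <- S) \sum_(i <- B) ((x \in A i) && (s x \notin A i)))).
  apply: leq_sum => x _; rewrite leq_subLR !wE -big_split/=.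
  by apply: leq_sum => i _; case: (x \in A i); case: (s x \in A i).
rewrite exchange_big/=; apply: leq_sum => i _.
rewrite -card_fset_filter; apply/fsubset_leq_card/fsubsetP => x.
by rewrite !inE => /andP[_].
Qed.

Lemma sum_card_layer : \sum_(t < N) #|` layer t| = \sum_(i <- B) #|` A i|.
Proof.
rewrite sum_layer; under eq_bigr do rewrite wE.
rewrite exchange_big/= !big_seq; apply: eq_bigr => i iB.
rewrite -card_fset_filter; congr #|` _|; apply/fsetP => x; rewrite !inE.
apply: andb_idl => xA; apply: wS; rewrite wE (big_fsetD1 i)//= xA.
by rewrite addn_gt0.
Qed.

End escape_theory.

(** * From left to two-sided almost invariance *)

Section two_sided.
Context {R : realType} {G : groupType}.
Local Open Scope fset_scope.
Local Open Scope nat_scope.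

(** The weight [w] is the convolution of the indicators of [A] and of its inverse [B]. It is a sum
    over translates [a B] and also over translates [A b]: the latter control left escape, the former
    right escape. A pigeonhole argument over the layers picks one that is good on both sides. *)
Lemma amenable_two_sided_almost_invariant (K : {fset G}) (n : nat) :
    amenable R G ->
  exists2 F : {fset G}, F != fset0 & forall k, k \in K ->
    n * #|` escape (fun x => k * x)%g F| <= #|` F| /\
    n * #|` escape (fun x => x * k)%g F| <= #|` F|.
Proof.
move=> amen.
(* If every layer failed, summation would give c |A|^2 <= 2 n |K| |A|^2, which the extra unit in [c]
   excludes. *)
pose c := n * (2 * #|` K|).+1.
(* Inverses are included because right translation by [k] on [B] corresponds to left translation by
   [k^-1] on [A]. *)
have [A A0 Ainv] := amenable_left_almost_invariant
  (K `|` [fset k^-1 | k in K])%g c amen.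
pose B := [fset a^-1 | a in A]%g.
have cB : #|` B| = #|` A| by rewrite card_imfset//; exact: invg_inj.
pose w x : nat := \sum_(a <- A) \sum_(b <- B) (x == a * b)%g.
pose S := prodfs A B.
have indic (f : G -> G) (D : {fset G}) x : injective f ->
    \sum_(y <- D) (x == f y) = (x \in f @` D).
  move=> finj; have [/imfsetP[/= y yD ->]|/imfsetP xD] := boolP (x \in _).
    rewrite (big_fsetD1 y)//= eqxx big_seq big1 => [//|z].
    by rewrite !inE (inj_eq finj) eq_sym => /andP[/negbTE->].
  rewrite big_seq big1// => y yD; case: eqP => // xy.
  by case: xD; exists y.
have wA x : w x = \sum_(a <- A) (x \in [fset a * b | b in B])%g.
  by apply: eq_bigr => a _; rewrite indic//; exact: mulgI.
have wB x : w x = \sum_(b <- B) (x \in [fset a * b | a in A])%g.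
  rewrite /w exchange_big/=.
  by apply: eq_bigr => b _; rewrite (indic (fun a => a * b)%g)//; exact: mulIg.
have wS x : 0 < w x -> x \in S.
  apply: contraTT => xS; rewrite -leqNgt leqn0 wA big_seq big1// => a aA.
  case: imfsetP => //= -[b bB xab]; case/negP: xS.
  by apply/prodfsP; exists a => //; exists b.
have wN x : w x <= #|` A|.
  by rewrite wA card_fset_sum1; apply: leq_sum => a _; exact: leq_b1.
have cardT : \sum_(t < #|` A|) #|` layer w S t| = #|` A| * #|` A|.
  rewrite (sum_card_layer wS wN wA).
  rewrite (eq_bigr (fun=> #|` A|)) => [|a _].
    by rewrite big_const_seq count_predT iter_addn_0.
  by rewrite card_imfset//; exact: mulgI.
have kB k : k \in K -> c * #|` escape (fun x => k * x)%g A| <= #|` A| /\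
     c * #|` escape (fun x => k^-1 * x)%g A| <= #|` A|.
  move=> kK; split; apply: Ainv; rewrite !inE ?kK//.
  by rewrite mem_imfset ?kK ?orbT//; exact: invg_inj.
pose eL k t := #|` escape (fun x => k * x)%g (layer w S t)|.
pose eR k t := #|` escape (fun x => x * k)%g (layer w S t)|.
have sumL k : k \in K -> c * \sum_(t < #|` A|) eL k t <= #|` A| * #|` A|.
  move=> /kB[kA _].
  apply: (@leq_trans (c * (#|` A| * #|` escape (fun x => k * x)%g A|))).
    rewrite leq_mul2l (leq_trans (sum_escape_layer_le wS wN wB _)) ?orbT//.
    rewrite (eq_bigr (fun=> #|` escape (fun x => k * x)%g A|)) => [|b _].
      by rewrite big_const_seq count_predT iter_addn_0 cB mulnC.
    by apply: card_escape_imfset => [|x]; [exact: mulIg|rewrite mulgA].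
  by nia.
have sumR k : k \in K -> c * \sum_(t < #|` A|) eR k t <= #|` A| * #|` A|.
  move=> /kB[_ kA].
  apply: (@leq_trans (c * (#|` A| * #|` escape (fun x => k^-1 * x)%g A|))).
    rewrite leq_mul2l (leq_trans (sum_escape_layer_le wS wN wA _)) ?orbT//.
    rewrite (eq_bigr (fun=> #|` escape (fun x => k^-1 * x)%g A|)) => [|a _].
      by rewrite big_const_seq count_predT iter_addn_0 mulnC.
    rewrite (@card_escape_imfset _ _ _ (fun x => x * k)%g) => [||x]; last 2 first.
    - exact: mulgI.
    - by rewrite mulgA.
    by apply: card_escape_imfset => [|x]; [exact: invg_inj|rewrite invgM invgK].
  by nia.
apply: contrapT => noF.
(* An empty layer satisfies the bound trivially; a nonempty one violating it would be the set
   sought. *)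
have bad t : #|` layer w S t| <= n * (\sum_(k <- K) (eL k t + eR k t)).
  have [->|L0] := eqVneq (layer w S t) fset0; first by rewrite cardfs0.
  rewrite leqNgt; apply/negP => ltn; apply: noF; exists (layer w S t) => // k kK.
  suff : n * (eL k t + eR k t) <= #|` layer w S t|.
    rewrite mulnDr => le; split; apply: leq_trans le.
      exact: leq_addr.
    exact: leq_addl.
  apply: leq_trans (ltnW ltn); rewrite leq_mul2l (big_fsetD1 k)//=.
  by rewrite leq_addr orbT.
have : c * (#|` A| * #|` A|) <= n * (2 * #|` K| * (#|` A| * #|` A|)).
  rewrite -{1}cardT.
  apply: (@leq_trans (c * \sum_(t < #|` A|) n * (\sum_(k <- K) (eL k t + eR k t)))).
    by rewrite leq_mul2l leq_sum ?orbT// => t _; exact: bad.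
  rewrite -big_distrr/= mulnCA leq_mul2l; apply/orP; right.
  rewrite exchange_big big_distrr/= -mulnA mulnCA.
  have -> : #|` K| * (2 * (#|` A| * #|` A|)) = \sum_(k <- K) 2 * (#|` A| * #|` A|).
    by rewrite big_const_seq count_predT iter_addn_0 mulnC.
  rewrite !big_seq; apply: leq_sum => k kK.
  by rewrite big_split/= mulnDr mul2n -addnn leq_add ?sumL ?sumR.
rewrite /c.
have : 0 < #|` A| by rewrite cardfs_gt0.
have : 0 < n.
  case: n noF {c bad sumL sumR Ainv kB} => // -[]; exists A => //.
by nia.
Qed.
End two_sided.

Local Open Scope classical_set_scope.
Local Open Scope ring_scope.

Lemma cvg_symdiff_ratio (R : realType) (T : choiceType) (s : T -> T)
    (F : nat -> {fset T}) (k0 : nat) : injective s ->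
    (forall k, F k != fset0) ->
    (forall k, (k0 <= k)%N -> (k.+1 * #|` escape s (F k)| <= #|` F k|)%N) ->
  (#|` fset_symdiff [fset s x | x in F k]%fset (F k)|%:R / #|` F k|%:R : R)
    @[k --> \oo] --> (0 : R).
Proof.
move=> sinj F0 Finv.
apply: (@squeeze_cvgr _ _ _ _ (fun=> 0) (fun k => 2 * (k.+1%:R)^-1)).
- near=> k; rewrite divr_ge0//= ler_pdivrMr ?ltr0n ?cardfs_gt0//.
  rewrite mulrAC ler_pdivlMr// -!natrM ler_nat.
  apply: (@leq_trans (2 * #|` escape s (F k)| * k.+1)%N).
    by rewrite leq_mul2r card_symdiff_imfset ?orbT.
  by rewrite -mulnA leq_mul2l/= mulnC; apply: Finv; near: k; exact: nbhs_infty_ge.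
- exact: cvg_cst.
- rewrite -[X in _ --> X](mulr0 2); apply: cvgMr; exact: cvg_harmonic.
Unshelve. all: by end_near. Qed.

(** Diagonal choice along an enumeration: the set of index [n] is almost invariant, with constant
    [n.+1], under the first [n] elements, so a given [g] is controlled from index [(e g).+1] on. *)
Lemma amenable_Folner (R : realType) (G : groupType) :
    countable [set: G] -> amenable R G ->
  exists F : nat -> {fset G}, left_Folner R F /\ right_Folner R F.
Proof.
move=> /countable_injP[e einj] amen.
(* A left inverse of [e], with the unit as default at indices that are not attained. *)
pose enumG (n : nat) : G := xget 1%g [set x | e x = n].
have eK x : enumG (e x) = x.
  rewrite /enumG; case: xgetP => [y _ /= exy|/(_ x)/(_ erefl)//].
  exact: (einj _ _ (mem_set I) (mem_set I) exy).
pose K n : {fset G} := [fset enumG i | i in iota 0 n]%fset.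
have inK x n : (e x < n)%N -> x \in K n.
  by move=> xn; apply/imfsetP; exists (e x); rewrite //= mem_iota.
pose F n := projT1 (cid2 (amenable_two_sided_almost_invariant (K n) n.+1 amen)).
have F0 n : F n != fset0 by rewrite /F; case: cid2.
have FK n : forall k, k \in K n ->
    (n.+1 * #|` escape (fun x => k * x)%g (F n)| <= #|` F n| /\
     n.+1 * #|` escape (fun x => x * k)%g (F n)| <= #|` F n|)%N.
  by rewrite /F; case: cid2.
exists F; split; split => // g.
- apply: (cvg_symdiff_ratio (k0 := (e g).+1) (@mulgI _ g)) => // k gk.
  by have [] := FK k g (inK _ _ gk).
- apply: (cvg_symdiff_ratio (k0 := (e g).+1) (@mulIg _ g)) => // k gk.
  by have [] := FK k g (inK _ _ gk).
Qed.

(** * Representing means by measures *)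

(** An alias of [Z], so that the algebra of clopen sets is attached to a type of its own. *)
Definition clopen_algebra (Z : ptopologicalType) : Type := Z.

Section clopen_algebra.
Variable Z : ptopologicalType.

Fact clopen_display : measure_display. Proof. by []. Qed.



HB.instance Definition _ := Pointed.on (clopen_algebra Z).

HB.instance Definition _ := @isAlgebraOfSets.Build clopen_display
  (clopen_algebra Z) (@clopen Z) (@clopen0 Z) (fun A B => @clopenU Z A B)
  (fun A => @clopenC Z A set0).

End clopen_algebra.

Section extension.
Context {R : realType} {Z : ptopologicalType}.
Hypothesis Z_compact : compact [set: Z].
Variable m : set Z -> R.
Hypothesis m_ge0 : forall A, 0 <= m A.
Hypothesis mT : m [set: Z] = 1.
Hypothesis mU : finitely_additive m.

Let clopen_compact (A : set Z) : clopen A -> compact A.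
Proof. by move=> [_ cA]; apply: subclosed_compact cA Z_compact _. Qed.

Let clopen_premeasure : set (clopen_algebra Z) -> \bar R := fun A => (m A)%:E.

(** A clopen union is compact and its members are open, so finitely many members already cover it
    and the partial sums are eventually constant. *)
Let semi_sigma_additive_clopen : semi_sigma_additive clopen_premeasure.
Proof.
move=> F mF tF mUF.
have [n UFn] : exists n, \bigcup_i F i = \big[setU/set0]_(i < n) F i.
  have := clopen_compact mUF; rewrite compact_cover.
  move=> /(_ _ setT F) [i _|//|D _ UD]; first by case: (mF i).
  exists (\max_(i <- D) i).+1%N; apply/seteqP; split => x.
    move=> /UD[i /= iD Fix]; rewrite -bigcup_mkord; exists i => //=.
    by rewrite ltnS; apply: (@leq_bigmax_seq _ _ xpredT id).
  by rewrite -bigcup_mkord => -[i _ Fix]; exists i.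
apply: cvg_near_cst; near=> k.
rewrite /clopen_premeasure sumEFin big_mkord.
rewrite -(finitely_additive_bigsetU (B := fun i : 'I_k => F i)) ?index_enum_uniq//;
  last first.
  by move=> i j x Fi Fj; apply/val_inj/(tF _ _ I I); exists x.
congr (m _)%:E.
rewrite -bigcup_mkord; apply/seteqP; split => [x [i _ Fix]|]; first by exists i.
rewrite UFn -bigcup_mkord => x [i /= iltn Fix]; exists i => //=.
by apply: leq_trans iltn _; near: k; exact: nbhs_infty_ge.
Unshelve. all: by end_near. Qed.

Theorem clopen_content_extension :
  exists P : probability (g_sigma_algebraType (@clopen Z)) R,
    forall A, clopen A -> P A = (m A)%:E.
Proof.
have pm0 : clopen_premeasure set0 = 0%E.
  by rewrite /clopen_premeasure finitely_additive0.
have pm_ge0 A : (0 <= clopen_premeasure A)%E by rewrite lee_fin.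
pose mM := isMeasure.Build _ _ _ clopen_premeasure pm0 pm_ge0
  semi_sigma_additive_clopen.
pose mu : {measure set (clopen_algebra Z) -> \bar R} :=
  HB.pack clopen_premeasure mM.
pose nu := measure_extension mu.
have nuE A : clopen A -> nu A = (m A)%:E.
  by move=> cA; rewrite /nu /measure_extension measurable_mu_extE.
have nuT : nu setT = 1%E by rewrite nuE ?mT//; exact: clopenT.
pose nuP := Measure_isProbability.Build _ _ _ nu nuT.
pose P : probability (g_sigma_algebraType (@clopen Z)) R := HB.pack nu nuP.
by exists P.
Qed.

End extension.

(** * Means on bounded functions *)

Section mean.
Context {R : realType} {T : Type}.
Implicit Types (f g : T -> R) (L : (T -> R) -> R).

Definition bdd f := exists M, forall x, `|f x| <= M.

(** Bounded functions are included whether continuous or not, since the mean is later composed with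
    a discontinuous section. Nothing is required of unbounded functions, for which a limit along an
    ultrafilter may fail to exist. *)
Definition is_mean L := [/\ L (cst 1) = 1,
  forall f, bdd f -> (forall x, 0 <= f x) -> 0 <= L f &
  forall a f g, bdd f -> bdd g -> L (fun x => a * f x + g x) = a * L f + L g].

Lemma bdd_cst (c : R) : bdd (fun=> c : R).
Proof. by exists `|c|. Qed.

Lemma bdd_lin a f g : bdd f -> bdd g -> bdd (fun x => a * f x + g x).
Proof.
move=> [M fM] [N gN]; exists (`|a| * M + N) => x.
by rewrite (le_trans (ler_normD _ _))// lerD// normrM ler_wpM2l.
Qed.

Lemma bdd_indic (A : set T) : bdd (\1_A : T -> R).
Proof. by exists 1 => x; rewrite indicE; case: (_ \in _); rewrite ?normr1 ?normr0. Qed.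

Lemma bdd_step (D : nat -> set T) (c : nat -> R) n :
  bdd (fun x => \sum_(i < n) c i * \1_(D i) x).
Proof.
elim: n => [|n [M fM]]; first by exists 0 => x; rewrite big_ord0 normr0.
exists (M + `|c n|) => x; rewrite big_ord_recr/= (le_trans (ler_normD _ _))// lerD//.
rewrite normrM indicE; case: (_ \in _); rewrite ?normr1 ?normr0 ?mulr1//.
by rewrite mulr0.
Qed.

Variable L : (T -> R) -> R.
Hypothesis L_mean : is_mean L.

Let L1 : L (cst 1) = 1. Proof. by case: L_mean. Qed.

Let Llin a f g : bdd f -> bdd g -> L (fun x => a * f x + g x) = a * L f + L g.
Proof. by case: L_mean => _ _ H bf bg; exact: H. Qed.

Let L0 : L (fun=> 0) = 0.
Proof.
have := Llin 1 (bdd_cst 0) (bdd_cst 0).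
by under eq_fun do rewrite mul1r addr0; rewrite mul1r; lra.
Qed.

(** Positivity applied to [e - (f - g)], and symmetrically. *)
Lemma mean_close f g e : bdd f -> bdd g -> (forall x, `|f x - g x| <= e) ->
  `|L f - L g| <= e.
Proof.
have oneside f' g' : bdd f' -> bdd g' -> (forall x, `|f' x - g' x| <= e) ->
    L f' - L g' <= e.
  move=> bf bg fg; have [_ L_ge0 _] := L_mean.
  have : 0 <= L (fun x => -1 * f' x + (e * 1 + g' x)).
    apply: L_ge0 => [|x]; first by do 2 apply: bdd_lin => //; exact: bdd_cst.
    by have := fg x; rewrite ler_norml => /andP[_]; lra.
  have b1 : bdd (cst 1 : T -> R) by exact: bdd_cst.
  rewrite Llin//; last by apply: bdd_lin.
  by rewrite (Llin e b1 bg) L1; lra.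
move=> bf bg fg; rewrite ler_norml; apply/andP; split; last exact: oneside.
by rewrite lerNl opprB; apply: oneside => // x; rewrite distrC.
Qed.

Lemma mean_step (D : nat -> set T) (c : nat -> R) n :
  L (fun x => \sum_(i < n) c i * \1_(D i) x) = \sum_(i < n) c i * L \1_(D i).
Proof.
elim: n => [|n IH].
  by under eq_fun do rewrite big_ord0; rewrite L0 big_ord0.
under eq_fun do rewrite big_ord_recr/= addrC.
by rewrite Llin ?IH ?big_ord_recr//= 1?addrC//; [exact: bdd_indic|exact: bdd_step].
Qed.

Lemma mean_content : [/\ forall A, 0 <= L \1_A, L \1_[set: T] = 1 &
  finitely_additive (fun A => L \1_A)].
Proof.
have [_ L_ge0 _] := L_mean; split.
- by move=> A; apply: L_ge0 => [|x]; [exact: bdd_indic|rewrite indicE].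
- by rewrite indicT.
- move=> A B AB; rewrite -[L \1_A]mul1r -Llin; try exact: bdd_indic.
  congr L; apply/funext => x; rewrite !indicE mul1r in_setU.
  have := congr1 (fun C => x \in C) AB; rewrite in_setI in_set0.
  by case: (x \in A); case: (x \in B); rewrite //= ?addr0 ?add0r.
Qed.

End mean.

Lemma mean_comp (R : realType) (S T : Type) (s : S -> T) (L : (S -> R) -> R) :
  is_mean L -> is_mean (fun f => L (f \o s)).
Proof.
have bs f : bdd f -> bdd (f \o s) by move=> [M fM]; exists M => x; exact: fM.
move=> [L1 L0 Ll]; split=> // [f bf f0|a f g bf bg].
- by apply: L0 => [|x]; [exact: bs|exact: f0].
- by rewrite -Ll//; exact: bs.
Qed.

Section bounded_integral.
Context d (T : measurableType d) (R : realType) (P : probability T R).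
Implicit Types f g : T -> R.

Lemma bdd_integrable f : measurable_fun setT f -> bdd f ->
  P.-integrable setT (EFin \o f).
Proof.
move=> mf [M fM]; apply: measurable_bounded_integrable => //.
  by rewrite ltey_eq fin_num_measure.
by exists M; split; [exact: num_real|move=> N MN x _; exact: le_trans (fM x) (ltW MN)].
Qed.

(** The counterpart of [mean_close]: integrals and means are compared through uniform approximation
    by step functions. *)
Lemma Rintegral_close f g e : measurable_fun setT f -> measurable_fun setT g ->
    bdd f -> bdd g -> (forall x, `|f x - g x| <= e) ->
  `|\int[P]_x f x - \int[P]_x g x| <= e.
Proof.
move=> mf mg bf bg fg.
have mfg : measurable_fun setT (fun x => f x - g x) by exact: measurable_funB.
have bfg : bdd (fun x => f x - g x) by exists e.
rewrite -RintegralB//; [|exact: bdd_integrable..].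
apply: (le_trans (le_normr_Rintegral _ _)) => //; first exact: bdd_integrable.
apply: (@le_trans _ _ (\int[P]_x (e : R))).
  apply: le_Rintegral => //.
  - apply: (@bdd_integrable (fun x => `|f x - g x|)); first exact: measurableT_comp.
    by exists e => x; rewrite normr_id.
  - by apply: bdd_integrable => //; exact: bdd_cst.
by rewrite Rintegral_cst//; have /= -> := probability_setT P; rewrite mulr1.
Qed.

Lemma Rintegral_step (D : nat -> set T) (c : nat -> R) n :
    (forall i, measurable (D i)) ->
  \int[P]_x (\sum_(i < n) c i * \1_(D i) x) = \sum_(i < n) c i * fine (P (D i)).
Proof.
move=> mD; elim: n => [|n IH].
  under eq_Rintegral do rewrite big_ord0.
  by rewrite Rintegral_cst// mul0r big_ord0.
under eq_Rintegral do rewrite big_ord_recr/=.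
have mI i : measurable_fun setT (\1_(D i) : T -> R) by exact: measurable_indic.
rewrite RintegralD//; last 2 first.
- apply: bdd_integrable; last exact: bdd_step.
  by apply: measurable_sum => i; apply: measurable_funM => //; exact: measurable_cst.
- apply: bdd_integrable; first exact: measurable_funM.
  have := bdd_lin (c n) (bdd_indic (D n)) (bdd_cst 0).
  by under eq_fun do rewrite addr0.
rewrite IH big_ord_recr/= RintegralZl//; last first.
  by apply: bdd_integrable => //; exact: bdd_indic.
by rewrite /Rintegral integral_indic// setIT.
Qed.

End bounded_integral.

Lemma compact_continuous_bdd (R : realType) (X : topologicalType) (f : X -> R) :
  compact [set: X] -> continuous f -> bdd f.
Proof.
move=> cX cf; have : compact (f @` setT).
  by apply: continuous_compact => //; exact: continuous_subspaceT.
move=> /compact_bounded[M [_ fM]]; exists (M + 1) => x.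
by apply: fM; [rewrite ltrDl|exists x].
Qed.

(** * Integration on compact zero-dimensional spaces *)

Section zero_dimensional.
Context {R : realType} {Z : ptopologicalType}.
Hypothesis Z_compact : compact [set: Z].
Hypothesis Z_hausdorff : hausdorff_space Z.
Hypothesis Z_zdim : zero_dimensional Z.

(** Finitely many clopen sets on which [g] varies little cover the space. Removing from each the
    earlier ones makes them disjoint, and the step function takes on each piece the value of [g] at
    a chosen centre. *)
Lemma clopen_step_approx (g : Z -> R) (e : R) : continuous g -> 0 < e ->
  exists n (D : nat -> set Z) (c : nat -> R), (forall i, clopen (D i)) /\
    forall x, `|g x - \sum_(i < n) c i * \1_(D i) x| <= e.
Proof.
move=> cg e0.
have nearC x : exists C : set Z,
    [/\ clopen C, C x & forall y, C y -> `|g x - g y| < e].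
  have : nbhs x [set y | `|g x - g y| < e] by have /cvgrPdist_lt/(_ e e0) := cg x.
  move=> /(zero_dimensional_cvg Z_hausdorff Z_zdim Z_compact)[C [Cx cC] Csub].
  by exists C.
pose C x := projT1 (cid (nearC x)).
have clC x : clopen (C x) by rewrite /C; case: cid => /= ? [].
have Cxx x : C x x by rewrite /C; case: cid => /= ? [].
have Cg x y : C x y -> `|g x - g y| < e by rewrite /C; case: cid => /= ? [_ _]; exact.
have := Z_compact; rewrite compact_cover => /(_ _ setT C)[x _|x _|s _ Zs].
- by case: (clC x).
- by exists x.
pose p := nth point (s : seq Z); pose n := size (s : seq Z).
pose D := seqDU (fun i => C (p i)).
have clD i : clopen (D i).
  rewrite /D /seqDU setDE; apply: clopenI => //; apply: (@clopenC _ _ set0).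
  by apply: (big_ind (@clopen Z)) => //; [exact: clopen0|exact: clopenU].
exists n, D, (g \o p); split=> // x.
have [i iltn Dix] : exists2 i, (i < n)%N & D i x.
  have : (\bigcup_(k < n) C (p k)) x.
    have [y /= ys Cyx] := Zs x I; exists (index y s); rewrite /= ?index_mem//.
    by rewrite /p nth_index.
  rewrite (bigcup_mkord n (fun k => C (p k))).
  rewrite (bigsetU_seqDU (fun k => C (p k))) -bigcup_mkord => -[i /= iltn Dix].
  by exists i.
rewrite (bigD1 (Ordinal iltn))//= big1 ?addr0 => [|j ji].
  rewrite indicE mem_set// mulr1 distrC ltW// Cg//.
  exact: (@subset_seqDU _ (fun i => C (p i))).
rewrite indicE memNset ?mulr0// => Djx; move/negP: ji; apply.
by apply/eqP/val_inj => /=; apply: (trivIset_seqDU (fun i => C (p i)) _ _ I I); exists x.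
Qed.

Variables (P : probability (g_sigma_algebraType (@clopen Z)) R).
Implicit Types g : Z -> R.

Lemma measurable_clopen (C : set (g_sigma_algebraType (@clopen Z))) :
  clopen (C : set Z) -> measurable C.
Proof. by move=> cC; apply: sub_gen_smallest. Qed.

(** The sigma-algebra is the one generated by the clopen sets, so measurability is obtained from a
    limit of clopen step functions. *)
Lemma continuous_measurable_clopen g : continuous g ->
  measurable_fun setT (g : g_sigma_algebraType (@clopen Z) -> R).
Proof.
move=> cg.
have ex n : exists h : g_sigma_algebraType (@clopen Z) -> R,
    measurable_fun setT h /\ forall x, `|g x - h x| <= n.+1%:R^-1.
  have n0 : 0 < n.+1%:R^-1 :> R by rewrite invr_gt0.
  have [k [D [c [clD Dg]]]] := clopen_step_approx cg n0.
  exists (fun x => \sum_(i < k) c i * \1_(D i) x); split=> //.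
  apply: measurable_sum => i; apply: measurable_funM => //.
  by apply: measurable_indic; exact: measurable_clopen.
pose h n := projT1 (cid (ex n)).
have hm n : measurable_fun setT (h n) by rewrite /h; case: cid => ? [].
have hg n x : `|g x - h n x| <= n.+1%:R^-1 by rewrite /h; case: cid => ? [].
apply: (@measurable_fun_cvg _ _ _ _ h) => // x _.
apply/cvgrPdist_le => e e0; near=> n.
apply: (le_trans (hg n x)); near: n.
have /cvgrPdist_le/(_ e e0) := @cvg_harmonic R.
by apply: filterS => n; rewrite sub0r normrN ger0_norm ?harmonic_ge0.
Unshelve. all: by end_near. Qed.

(** Both sides agree on clopen step functions and are 1-Lipschitz for the uniform norm. *)
Lemma Rintegral_mean_clopen (L : (Z -> R) -> R) : is_mean L ->
    (forall C, clopen C -> P C = (L \1_C)%:E) ->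
  forall g, continuous g -> \int[P]_x g x = L g.
Proof.
move=> meanL PL g cg; apply/eqP; rewrite -subr_eq0 -normr_le0.
apply/ler_addgt0Pl => e e0; rewrite addr0.
have e2 : 0 < e / 2 by rewrite divr_gt0.
have [n [D [c [clD Dg]]]] := clopen_step_approx cg e2.
have bg := compact_continuous_bdd Z_compact cg.
have mD i : measurable (D i : set (g_sigma_algebraType (@clopen Z))).
  exact: measurable_clopen.
have H1 := mean_close meanL bg (bdd_step D c n) Dg.
have H2 : `|\int[P]_x g x - \int[P]_x (\sum_(i < n) c i * \1_(D i) x)| <= e / 2.
  apply: Rintegral_close => //; last exact: bdd_step.
  - exact: continuous_measurable_clopen.
  - by apply: measurable_sum => i; apply: measurable_funM => //; exact: measurable_indic.
move: H1 H2; rewrite (mean_step meanL) Rintegral_step//.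
rewrite [in X in _ -> X -> _](eq_bigr (fun i : 'I_n => c i * L \1_(D i))); last first.
  by move=> i _; rewrite PL.
set S := \sum_(i < n) _.
by rewrite !ler_norml => /andP[? ?] /andP[? ?]; apply/andP; split; lra.
Qed.

End zero_dimensional.

Lemma continuous_borel_measurable (R : realType) (X : ptopologicalType)
  (f : X -> R) : continuous f -> measurable_fun setT (f : borel X -> R).
Proof.
move=> cf; apply: (measurability _ (RGenOInfty.measurableE R)) => _ [_ [x ->] <-].
rewrite setTI; apply: sub_gen_smallest.
by apply: open_comp => [? _|]; [exact: cf|exact: interval_open].
Qed.

(** * Representation of means on compact metrizable spaces *)

Section metrizable.
Context {R : realType} {X : ptopologicalType}.
Hypothesis X_compact : compact [set: X].
Hypothesis X_metrizable : metrizable R X.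

Lemma cantor_cover : exists p : cantor_space -> X,
  continuous p /\ forall x, exists z, p z = x.
Proof.
have [M [h [h' [ch ch' hK h'K]]]] := X_metrizable.
pose ptM := isPointed.Build M (h point).
pose PM : pseudoPMetricType R := HB.pack M ptM.
have cM : compact [set: PM].
  have -> : [set: PM] = h @` [set: X].
    by apply/seteqP; split => // y _; exists (h' y).
  by apply: continuous_compact => //; exact: continuous_subspaceT.
have hM : hausdorff_space PM by exact: (@metric_hausdorff R M).
have [q cq] := cantor_surj cM hM.
exists (h' \o q); split.
  by move=> z; apply: continuous_comp; [exact: cq|exact: ch'].
move=> x; have [z _ qz] := 'surj_q (I : [set: PM] (h x)).
by exists z; rewrite /= qz hK.
Qed.

(** The function is the distance to the complement of [V], read through the homeomorphism. It lets
    continuous functions detect open sets, both for the measurability of the Cantor surjection and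
    for the uniqueness of measures. *)
Lemma open_positive (V : set X) : open V ->
  exists f : X -> R, [/\ continuous f, forall x, 0 <= f x & forall x, V x <-> 0 < f x].
Proof.
have [M [h [h' [ch ch' hK h'K]]]] := X_metrizable.
(* When [V] is the whole space there is no distance to take an infimum of, and a constant serves. *)
move=> oV; have [VT|] := pselect (V = setT).
  exists (cst 1); split => [||x]; rewrite ?VT//; exact: cst_continuous.
move=> VT; have [x0 Vx0] : exists x0, ~ V x0.
  apply: contrapT => /forallNP nV; apply: VT; apply/seteqP; split=> // x _.
  exact: contrapT (nV x).
pose S x := [set mdist (h x) (h y) | y in ~` V].
have S_inf x : has_inf (S x).
  split; first by exists (mdist (h x) (h x0)); exists x0.
  by exists 0 => _ [y _ <-]; exact: mdist_ge0.
pose f x : R := inf (S x).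
have f_ge0 x : 0 <= f x.
  by apply: lb_le_inf; [case: (S_inf x)|move=> _ [y _ <-]; exact: mdist_ge0].
have flip x y : f x <= mdist (h x) (h y) + f y.
  rewrite -lerBlDl; apply: lb_le_inf; first by case: (S_inf y).
  move=> _ [z Vz <-]; rewrite lerBlDl (le_trans _ (metric_triangle _ (h y) _))//.
  by apply: ge_inf; [case: (S_inf x)|exists z].
exists f; split=> // x.
  apply/cvgrPdist_lt => e e0.
  have : nbhs x (h @^-1` ball (h x) e) by apply: ch; exact: nbhsx_ballx.
  apply: filterS => y /=; rewrite ballEmdist/= => xy.
  rewrite ltr_norml; apply/andP; split.
    by have := flip y x; rewrite metric_sym; lra.
  by have := flip x y; lra.
split=> [Vx|fx]; last first.
  apply: contrapT => Vx; move: fx; rewrite ltNge => /negP; apply.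
  by rewrite -(mdistxx (h x)); apply: ge_inf; [case: (S_inf x)|exists x].
have oW : open (h' @^-1` V) by apply: open_comp => // ? _; exact: ch'.
have : nbhs (h x) (h' @^-1` V) by apply: open_nbhs_nbhs; split=> //=; rewrite hK.
move=> /nbhs_ballP[e /= e0 eV]; apply: (lt_le_trans e0).
apply: lb_le_inf; first by case: (S_inf x).
move=> _ [y Vy <-]; rewrite leNgt; apply/negP => xy; apply: Vy.
by rewrite -(hK y); apply: eV; rewrite ballEmdist.
Qed.

Theorem mean_representation (L : (X -> R) -> R) : is_mean L ->
  exists mu : probability (borel X) R,
    forall f : X -> R, continuous f -> \int[mu]_x f x = L f.
Proof.
move=> meanL; have [p [cp psurj]] := cantor_cover.
(* An arbitrary section of [p], along which the mean is transported to the Cantor space. *)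
pose s x := projT1 (cid (psurj x)).
have sK x : p (s x) = x by rewrite /s; case: cid.
have meanLs := mean_comp s meanL.
have [m_ge0 mT mU] := mean_content meanLs.
have cC := cantor_space_compact.
have [P PE] := clopen_content_extension cC m_ge0 mT mU.
(* As [p \o s] is the identity, the transported mean of [f \o p] is [L f]. *)
have int_lift (f : X -> R) : continuous f -> \int[P]_x f (p x) = L f.
  move=> cf.
  rewrite (Rintegral_mean_clopen cC cantor_space_hausdorff cantor_zero_dimensional
     meanLs PE (g := f \o p)).
    by congr L; apply/funext => x; rewrite /= sK.
  by move=> z; apply: continuous_comp; [exact: cp|exact: cf].
pose C := g_sigma_algebraType (@clopen cantor_space).
have mcomp (f : X -> R) : continuous f -> measurable_fun [set: C] (f \o p).
  move=> cf; apply: (continuous_measurable_clopen cC cantor_space_hausdorff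
    cantor_zero_dimensional).
  by move=> z; apply: continuous_comp; [exact: cp|exact: cf].
(* The preimage of an open set is the positivity set of a continuous function, hence lies in the
   sigma-algebra generated by the clopen sets. *)
have mp : measurable_fun [set: C] (p : _ -> borel X).
  apply: (@measurability _ _ C (borel X) setT p (@open X)) => // _ [V oV <-].
  have [f [cf f0 Vf]] := open_positive oV.
  have -> : p @^-1` V = (f \o p) @^-1` `]0, +oo[%classic.
    by apply/seteqP; split => z /=; rewrite in_itv/= andbT => /Vf.
  by apply: mcomp.
exists (distribution P (mfun_Sub (mem_set mp))) => f cf.
rewrite -int_lift// /Rintegral integral_distribution//.
- by apply/measurable_EFinP; exact: continuous_borel_measurable.
- apply: bdd_integrable; first exact: mcomp.
  have [M fM] := compact_continuous_bdd X_compact cf.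
  by exists M => z; exact: fM.
Qed.

End metrizable.

Lemma bounded_convergence d (T : measurableType d) (R : realType)
    (P : probability T R) (f_ : nat -> T -> R) (f : T -> R) (M : R) :
    (forall n, measurable_fun setT (f_ n)) ->
    (forall n x, `|f_ n x| <= M) ->
    (forall x, f_ n x @[n --> \oo] --> f x) ->
  \int[P]_x f_ n x @[n --> \oo] --> \int[P]_x f x.
Proof.
move=> mf_ f_M f_f.
have mf : measurable_fun setT f by apply: (@measurable_fun_cvg _ _ _ _ f_).
have bf : bdd f.
  exists M => x; have : `|f_ n x| @[n --> \oo] --> `|f x| by apply: cvg_norm.
  by move=> /cvgr_to_le; apply; exact: nearW.
have H := @dominated_cvg _ T R P setT measurableT (fun n => EFin \o f_ n)
  (EFin \o f) (cst M%:E).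
have {}H : (\int[P]_x (f_ n x)%:E)%E @[n --> \oo] --> (\int[P]_x f x)%:E.
  rewrite /Rintegral fineK; last exact/integrable_fin_num/bdd_integrable.
  apply: H => [n|x _|||n x _] //=.
  - by apply/measurable_EFinP; exact: mf_.
  - by apply: cvg_EFin; [exact: nearW|exact: f_f].
  - by apply: bdd_integrable; [exact: measurable_cst|exact: bdd_cst].
  - by rewrite lee_fin.
exact: (fine_cvg H).
Qed.

(** Open sets form a pi-system generating the Borel sets, and the indicator of an open set is the
    limit of min(1, n f) with [f] positive exactly on that set. *)
Lemma borel_probability_eq (R : realType) (X : ptopologicalType)
    (mu nu : probability (borel X) R) :
    compact [set: X] -> metrizable R X ->
    (forall f : X -> R, continuous f -> \int[mu]_x f x = \int[nu]_x f x) ->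
  forall A : set (borel X), measurable A -> mu A = nu A.
Proof.
move=> cX mX eq_int A mA.
apply: (@measure_unique _ _ (borel X) (@open X) (fun=> setT)) => //.
- by move=> ? ?; exact: openI.
- by move=> _; exact: openT.
- by rewrite bigcup_const.
- move=> V oV; have [f [cf f0 Vf]] := open_positive mX oV.
  pose g (n : nat) x : R := Num.min 1 (n%:R * f x).
  have cg n : continuous (g n).
    suff : continuous (cst 1 \min (fun x => n%:R * f x)) by [].
    move=> x; apply: continuous_min; first exact: cst_continuous.
    by apply: cvgMr; exact: cf.
  have g1 n x : `|g n x| <= 1.
    by rewrite ger0_norm /g ?ge_min ?lexx// le_min ler01 mulr_ge0.
  have gV x : g n x @[n --> \oo] --> (\1_V x : R).
    apply: cvg_near_cst; rewrite indicE.
    have [/set_mem Vx|/negP Vx] := boolP (x \in V).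
      have fx : 0 < f x by apply/Vf.
      near=> n; rewrite /g min_l// -ler_pdivrMr// mul1r.
      by near: n; exact: nbhs_infty_ger.
    have fx : f x = 0.
      apply/eqP; rewrite eq_le f0 andbT leNgt; apply/negP => /Vf ?.
      by apply: Vx; exact/mem_set.
    by apply: nearW => n; rewrite /g fx mulr0 min_r.
  have lim_eq (P : probability (borel X) R) :
      \int[P]_x g n x @[n --> \oo] --> fine (P V).
    have -> : fine (P V) = \int[P]_x (\1_V x : R).
      by rewrite /Rintegral integral_indic// ?setIT//; exact: sub_gen_smallest.
    apply: (bounded_convergence (M := 1)) => // n.
    exact: continuous_borel_measurable.
  have mV : measurable (V : set (borel X)) by exact: sub_gen_smallest.
  transitivity (fine (mu V))%:E; first by rewrite fineK// fin_num_measure.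
  transitivity (fine (nu V))%:E; last by rewrite fineK// fin_num_measure.
  congr (_%:E); apply: (cvg_unique _ (lim_eq mu)) => //.
  rewrite (_ : (fun n => _) = (fun n => \int[nu]_x g n x)); first exact: lim_eq.
  by apply/funext => n; exact: eq_int.
- by move=> _; rewrite ltey_eq fin_num_measure.
Unshelve. all: by end_near. Qed.

(** * Averages and invariant measures *)

(** Compactness of the segment gives a cluster point, and an ultrafilter converges to each of its
    cluster points. *)
Lemma ultra_bounded_cvg (R : realType) (I : Type) (W : set_system I)
    (u : I -> R) (M : R) : UltraFilter W -> (forall i, `|u i| <= M) ->
  cvg (u i @[i --> W]).
Proof.
move=> WU uM.
have [l [_ lcl]] : `[- M, M] `&` cluster (u @ W) !=set0.
  apply: segment_compact; apply: (@filterE _ W) => i.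
  by have := uM i; rewrite ler_norml /= in_itv.
apply/cvg_ex; exists l => V Vl.
have [//|WnV] := in_ultra_setVsetC (u @^-1` V) WU.
by have [y []] := lcl (~` V) V WnV Vl.
Qed.

Lemma continuous_borel (X Y : ptopologicalType) (p : X -> Y) : continuous p ->
  measurable_fun setT (p : borel X -> borel Y).
Proof.
move=> cp; apply: (@measurability _ _ (borel X) (borel Y) setT p (@open Y)) => //.
move=> _ [V oV <-]; rewrite setTI; apply: sub_gen_smallest.
by apply: open_comp => // ? _; exact: cp.
Qed.

Lemma Rintegral_distribution (R : realType) (X Y : ptopologicalType)
    (mu : probability (borel X) R) (p : {mfun borel X >-> borel Y})
    (f : Y -> R) : compact [set: Y] -> continuous f ->
  \int[distribution mu p]_y f y = \int[mu]_x f (p x).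
Proof.
move=> cY cf; have mf := continuous_borel_measurable cf.
rewrite /Rintegral integral_distribution//; first exact/measurable_EFinP.
apply: (@bdd_integrable _ _ _ mu (f \o p)); first exact: measurableT_comp.
by have [M fM] := compact_continuous_bdd cY cf; exists M => x; exact: fM.
Qed.

(** The terms over the intersection cancel. *)
Lemma sum_symdiff_le (R : realType) (T : choiceType) (A B : {fset T})
    (f : T -> R) (M : R) : (forall x, `|f x| <= M) ->
  `|\sum_(x <- A) f x - \sum_(x <- B) f x| <= M * #|` fset_symdiff A B|%:R.
Proof.
move=> fM.
have part (C D : {fset T}) : \sum_(x <- C) f x =
    \sum_(x <- (C `&` D)%fset) f x + \sum_(x <- (C `\` D)%fset) f x.
  rewrite (big_fsetID _ (mem D))/=; congr (_ + _);
    by apply: eq_fbigl => x; rewrite !inE 1?andbC.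
have bound (C : {fset T}) : `|\sum_(x <- C) f x| <= M * #|` C|%:R.
  rewrite card_fset_sum1 natr_sum mulr_sumr (le_trans (ler_norm_sum _ _ _))//.
  by apply: ler_sum => x _; rewrite mulr1.
rewrite (part A B) (part B A) fsetIC opprD addrACA subrr add0r.
rewrite (le_trans (ler_normB _ _))// (le_trans (lerD (bound _) (bound _)))//.
rewrite -mulrDr -natrD /fset_symdiff cardfsU [X in (_ - X)%N](_ : _ = 0%N) ?subn0//.
apply/eqP; rewrite cardfs_eq0; apply/eqP/fsetP => x; rewrite !inE.
by case: (x \in A); case: (x \in B).
Qed.

Section real_averages.
Context {R : realType} {X : ptopologicalType} {G : groupType}.
Variable U : G -> X -> X.
Implicit Types (F : {fset G}) (f : X -> R).

Definition ravg F f x : R := #|` F|%:R^-1 * \sum_(g <- F) f (U g x).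

Let cardF_neq0 F : F != fset0 -> #|` F|%:R != 0 :> R.
Proof. by rewrite pnatr_eq0 cardfs_eq0. Qed.

Lemma ravg_cst F c x : F != fset0 -> ravg F (cst c) x = c.
Proof.
move=> F0; rewrite /ravg (eq_bigr (fun=> c * 1%:R)) => [|g _]; last by rewrite mulr1.
by rewrite -mulr_sumr -natr_sum -card_fset_sum1 mulrCA mulVf ?mulr1// cardF_neq0.
Qed.

Lemma ravg_lin F a f h x :
  ravg F (fun y => a * f y + h y) x = a * ravg F f x + ravg F h x.
Proof. by rewrite /ravg big_split/= -mulr_sumr mulrDr mulrCA. Qed.

Lemma ravg_ge0 F f x : (forall y, 0 <= f y) -> 0 <= ravg F f x.
Proof. by move=> f0; rewrite mulr_ge0 ?invr_ge0// sumr_ge0. Qed.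

Lemma ravg_le F f M x : F != fset0 -> (forall y, `|f y| <= M) -> `|ravg F f x| <= M.
Proof.
move=> F0 fM; rewrite -(ravg_cst M x F0) /ravg normrM ger0_norm ?invr_ge0//.
rewrite ler_wpM2l ?invr_ge0// (le_trans (ler_norm_sum _ _ _))//.
exact: ler_sum.
Qed.

(** Since [U (g * h)] is [U h \o U g], averaging [f \o U h] over [F] amounts to averaging [f] over
    the right translate of [F] by [h]. *)
Lemma ravg_shift F f M h x : dynamical_system U ->
    (forall y, `|f y| <= M) ->
  `|ravg F (f \o U h) x - ravg F f x| <=
  M * (#|` fset_symdiff [fset (g * h)%g | g in F]%fset F|%:R / #|` F|%:R).
Proof.
move=> [_ UM] fM; rewrite /ravg -mulrBr normrM ger0_norm ?invr_ge0//.
have -> : \sum_(g <- F) (f \o U h) (U g x) =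
    \sum_(g <- [fset (g * h)%g | g in F]%fset) f (U g x).
  rewrite big_imfset/=; last by move=> ? ? _ _; exact: mulIg.
  by apply: eq_bigr => g _; rewrite UM.
rewrite mulrA [leRHS]mulrC ler_wpM2l ?invr_ge0//.
exact: (sum_symdiff_le _ _ (f := fun g => f (U g x))).
Qed.

Lemma ravg_continuous F f : dynamical_system U -> continuous f ->
  continuous (ravg F f).
Proof.
move=> [UH _] cf x; apply: cvgMr; apply: cvg_big => [|g _]; first exact: add_continuous.
have [? [cU _ _ _]] := UH g.
by apply: continuous_comp; [exact: cU|exact: cf].
Qed.

Variable W : set_system nat.
Hypothesis W_ultra : UltraFilter W.
Hypothesis W_oo : \oo `<=` W.
Hypothesis X_compact : compact [set: X].
Hypothesis X_metrizable : metrizable R X.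
Hypothesis XGU : dynamical_system U.

(* The measure represents the mean [f |-> lim_W (Avg_(F k) f) (x_ k)]; the right
   Folner property is exactly what makes this mean invariant. *)
Theorem invariant_limit_measure (F : nat -> {fset G}) (x_ : nat -> X) :
    right_Folner R F ->
  exists2 nu : probability (borel X) R, invariant_measure U nu &
    forall f : X -> R, continuous f ->
      ravg (F k) f (x_ k) @[k --> W] --> \int[nu]_x f x.
Proof.
move=> [F0 FF].
pose L (f : X -> R) : R := lim (ravg (F k) f (x_ k) @[k --> W]).
have Lcvg f : bdd f -> ravg (F k) f (x_ k) @[k --> W] --> L f.
  by move=> [M fM]; apply: (@ultra_bounded_cvg _ _ _ _ M) => // k; exact: ravg_le.
have L_mean : is_mean L.
  split=> [|f bf f0|a f g bf bg].
  - apply/cvg_lim => //; apply: cvg_near_cst; apply: filterE => k.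
    exact: (ravg_cst 1).
  - by apply: limr_ge; [exact: Lcvg|apply: filterE => k; exact: ravg_ge0].
  - apply/cvg_lim => //; under eq_fun do rewrite ravg_lin.
    by apply: cvgD; [apply: cvgMr; exact: Lcvg|exact: Lcvg].
have [nu nuE] := mean_representation X_compact X_metrizable L_mean.
exists nu; last by move=> f cf; rewrite nuE//; apply: Lcvg; exact: compact_continuous_bdd.
move=> h A mA.
have [UH UM] := XGU; have [? [cU _ _ _]] := UH h.
pose Uh : {mfun borel X >-> borel X} := mfun_Sub (mem_set (continuous_borel cU)).
(* Invariance is equality of [nu] with its pushforward, which can be tested on continuous
   functions. *)
have -> : nu (U h @^-1` A) = distribution nu Uh A by [].
apply: borel_probability_eq => // f cf.
have cfU : continuous (f \o U h).
  by move=> x; apply: continuous_comp; [exact: cU|exact: cf].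
rewrite Rintegral_distribution// (nuE _ cfU) nuE//.
have [M fM] := compact_continuous_bdd X_compact cf.
have bf : bdd f by exists M.
have bfU : bdd (f \o U h) by exists M => x; exact: fM.
apply/eqP; rewrite -subr_eq0; apply/eqP.
have c1 : ravg (F k) (f \o U h) (x_ k) - ravg (F k) f (x_ k) @[k --> W] -->
    L (f \o U h) - L f.
  by apply: cvgB; exact: Lcvg.
apply: (cvg_unique _ c1) => //.
(* As [W] refines [\oo], ordinary convergence to 0 suffices. *)
apply: cvg_trans (cvg_app _ W_oo) _.
apply: norm_cvg0.
apply: (@squeeze_cvgr _ _ _ _ (fun=> 0) (fun k =>
  M * (#|` fset_symdiff [fset (g * h)%g | g in F k]%fset (F k)|%:R / #|` F k|%:R))).
- by apply: nearW => k; rewrite normr_ge0 ravg_shift.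
- exact: cvg_cst.
- by rewrite -[X in _ --> X](mulr0 M); apply: cvgMr; exact: FF.
Qed.

End real_averages.

(** * Unique ergodicity and convergence of real averages *)

Section unique_ergodicity.
Context {R : realType} {X : ptopologicalType} {G : groupType}.
Variable U : G -> X -> X.
Hypothesis X_compact : compact [set: X].
Hypothesis X_metrizable : metrizable R X.
Hypothesis XGU : dynamical_system U.

Lemma Rintegral_ravg (nu : probability (borel X) R) (F : {fset G}) (f : X -> R) :
    invariant_measure U nu -> F != fset0 -> continuous f ->
  \int[nu]_x ravg U F f x = \int[nu]_x f x.
Proof.
move=> nuU F0 cf; have [UH _] := XGU.
have cfU g : continuous (f \o U g).
  have [? [cU _ _ _]] := UH g.
  by move=> x; apply: continuous_comp; [exact: cU|exact: cf].
have intf (h : X -> R) : continuous h -> nu.-integrable setT (EFin \o h).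
  move=> ch; apply: bdd_integrable; first exact: continuous_borel_measurable.
  exact: compact_continuous_bdd.
have eqU g : \int[nu]_x f (U g x) = \int[nu]_x f x.
  have [? [cU _ _ _]] := UH g.
  pose Ug : {mfun borel X >-> borel X} := mfun_Sub (mem_set (continuous_borel cU)).
  rewrite -(Rintegral_distribution nu Ug X_compact cf); congr fine.
  by apply: eq_measure_integral => A mA _; exact: nuU.
rewrite /ravg RintegralZl//; last first.
  apply: intf; apply: continuous_big => [|g _]; [exact: add_continuous|exact: cfU].
have -> : \int[nu]_x (\sum_(g <- F) f (U g x)) = \sum_(g <- F) \int[nu]_x f x.
  elim: (F : seq G) => [|g s IH].
    under eq_Rintegral do rewrite big_nil.
    by rewrite Rintegral_cst// mul0r big_nil.
  under eq_Rintegral do rewrite big_cons.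
  rewrite RintegralD//; [by rewrite big_cons eqU IH|exact: intf (cfU g)|].
  by apply: intf; apply: continuous_big => [|? _]; [exact: add_continuous|exact: cfU].
rewrite (eq_bigr (fun=> \int[nu]_x f x * 1%:R)) => [|g _]; last by rewrite mulr1.
rewrite -mulr_sumr -natr_sum -card_fset_sum1 mulrCA mulVf ?mulr1//.
by rewrite pnatr_eq0 cardfs_eq0.
Qed.

(** The averages all have the same [nu]-integral as [f], while by bounded convergence these
    integrals tend to that of the constant limit. *)
Lemma pointwise_invariant_eq (mu nu : probability (borel X) R)
    (F : nat -> {fset G}) : (forall k, F k != fset0) ->
    (forall f : X -> R, continuous f ->
      forall x, ravg U (F k) f x @[k --> \oo] --> \int[mu]_x f x) ->
    invariant_measure U nu ->
  forall A : set (borel X), measurable A -> nu A = mu A.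
Proof.
move=> F0 Fmu nuU; apply: borel_probability_eq => // f cf.
have [M fM] := compact_continuous_bdd X_compact cf.
have : \int[nu]_x ravg U (F k) f x @[k --> \oo] --> \int[nu]_x (\int[mu]_x f x).
  apply: (bounded_convergence (M := M)) => [k|k x|x].
  - by apply: continuous_borel_measurable; exact: ravg_continuous.
  - exact: ravg_le.
  - exact: Fmu.
under eq_fun do rewrite Rintegral_ravg//.
have -> : \int[nu]_x (\int[mu]_x f x) = \int[mu]_x f x.
  by rewrite Rintegral_cst//; have /= -> := probability_setT nu; rewrite mulr1.
by move=> /(cvg_unique _ (cvg_cst _)); apply.
Qed.

(** The Krylov-Bogoliubov construction, with averages along the orbit of one fixed point. *)
Lemma exists_invariant_measure (F : nat -> {fset G}) : right_Folner R F ->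
  exists nu : probability (borel X) R, invariant_measure U nu.
Proof.
move=> FF; have [W [W_ultra W_oo]] := ultraFilterLemma eventually_filter.
have [nu nuU _] := invariant_limit_measure W_ultra W_oo X_compact X_metrizable
  XGU (fun=> point) FF.
by exists nu.
Qed.

(** [F'] provides an invariant measure and [F] shows that it is the only one. As [mu] is not assumed
    invariant, it serves as the common value with which invariant measures are compared. *)
Lemma pointwise_uniquely_ergodic (mu : probability (borel X) R)
    (F F' : nat -> {fset G}) : right_Folner R F' ->
    (forall k, F k != fset0) ->
    (forall f : X -> R, continuous f ->
      forall x, ravg U (F k) f x @[k --> \oo] --> \int[mu]_x f x) ->
  uniquely_ergodic R U.
Proof.
move=> /exists_invariant_measure[nu nuU] F0 Fmu; exists nu => // nu' nu'U A mA.
by rewrite !(pointwise_invariant_eq F0 Fmu).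
Qed.

(** Otherwise infinitely many averages deviate by at least [e] at suitable points. Their limit along
    an ultrafilter on the bad indices is the integral against an invariant measure, hence against
    [mu], which contradicts the deviation. *)
Lemma uniquely_ergodic_uniform (mu : probability (borel X) R)
    (F : nat -> {fset G}) (f : X -> R) (e : R) :
    (forall nu : probability (borel X) R, invariant_measure U nu ->
      forall A : set (borel X), measurable A -> nu A = mu A) ->
    right_Folner R F -> continuous f -> 0 < e ->
  \forall k \near \oo, forall x, `|ravg U (F k) f x - \int[mu]_x f x| < e.
Proof.
move=> mu_unique FF cf e0.
pose good k := forall x, `|ravg U (F k) f x - \int[mu]_x f x| < e.
apply: contrapT => nogood.
(* The restriction of [\oo] to the bad indices is proper because [good] does not hold eventually. *)
have bad_proper : ProperFilter (within (~` good) \oo).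
  split; last exact: within_filter.
  move=> H; apply: nogood; apply: (@filterS _ \oo _ _ good _ H) => k Hk.
  by apply: contrapT => /Hk.
have [W [W_ultra Wbad]] := ultraFilterLemma bad_proper.
have W_oo : \oo `<=` W.
  by move=> A oA; apply: Wbad; rewrite /within/=; apply: filterS oA.
(* At good indices the point is a default value; the bad indices form a set of [W]. *)
have ex k : exists x, ~ good k -> e <= `|ravg U (F k) f x - \int[mu]_x f x|.
  have [g|/existsNP[x /negP]] := pselect (good k); first by exists point.
  by rewrite -leNgt => ex; exists x.
pose x_ k := projT1 (cid (ex k)).
have xP k : ~ good k -> e <= `|ravg U (F k) f (x_ k) - \int[mu]_x f x|.
  by rewrite /x_; case: cid.
have [nu nuU /(_ f cf) cvg_nu] := invariant_limit_measure W_ultra W_oo X_compact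
  X_metrizable XGU x_ FF.
have nu_mu : \int[nu]_x f x = \int[mu]_x f x.
  by congr fine; apply: eq_measure_integral => A mA _; exact: mu_unique.
have Wbad' : W (~` good) by apply: Wbad; apply: withinT.
have cvgN : `|ravg U (F k) f (x_ k) - \int[mu]_x f x| @[k --> W] --> (0 : R).
  have : ravg U (F k) f (x_ k) - \int[mu]_x f x @[k --> W] --> (0 : R).
    by rewrite -(subrr (\int[nu]_x f x)) {2}nu_mu; apply: cvgB => //; exact: cvg_cst.
  by move=> /cvg_norm; rewrite normr0.
suff : e <= 0 by rewrite leNgt e0.
apply: (cvgr_to_ge cvgN).
exact: (@filterS _ W _ (~` good)
  (fun k => e <= `|ravg U (F k) f (x_ k) - \int[mu]_x f x|) xP Wbad').
Qed.
End unique_ergodicity.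

(** * Reduction of complex functions to real and imaginary parts *)

Local Open Scope complex_scope.

Section complex_topology.
Variable R : realType.
Implicit Types z w : R[i]^o.

Lemma normc_ge_Im (z : R[i]) : `|complex.Im z|%:C <= `|z|.
Proof.
rewrite normc_def lecR -sqrtr_sqr ler_wsqrtr// lerDr sqr_ge0//.
Qed.

Lemma normc_le_ReIm (z : R[i]) : `|z| <= (`|complex.Re z| + `|complex.Im z|)%:C.
Proof.
case: z => a b /=; rewrite normc_def lecR /= -(@ler_sqr _ _ _) ?nnegrE ?addr_ge0//.
rewrite sqr_sqrtr ?addr_ge0 ?sqr_ge0// sqrrD !real_normK ?num_real//.
by rewrite lerD2r lerDl mulrn_wge0// mulr_ge0.
Qed.

Lemma complex_eps (e : R[i]) : 0 < e -> exists2 r : R, 0 < r & e = r%:C.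
Proof.
case: e => a b; rewrite ltcE /= => /andP[/eqP -> a0]; by exists a.
Qed.

Lemma cvg_complexP (I : Type) (F : set_system I) (FF : Filter F)
    (u : I -> R[i]^o) (z : R[i]^o) :
  u i @[i --> F] --> z <->
  (complex.Re (u i) @[i --> F] --> complex.Re z) /\
  (complex.Im (u i) @[i --> F] --> complex.Im z).
Proof.
split=> [uz|[uR uI]].
  split; apply/cvgrPdist_lt => e e0.
    have /cvgrPdist_lt/(_ e%:C) := uz; rewrite ltcR => /(_ e0).
    apply: filterS => i; rewrite -ltcR; apply: le_lt_trans.
    by rewrite -raddfB normc_ge_Re.
  have /cvgrPdist_lt/(_ e%:C) := uz; rewrite ltcR => /(_ e0).
  apply: filterS => i; rewrite -ltcR; apply: le_lt_trans.
  by rewrite -raddfB normc_ge_Im.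
apply/cvgrPdist_lt => _ /complex_eps[e e0 ->].
have e2 : 0 < e / 2 by rewrite divr_gt0.
move/cvgrPdist_lt : uR => /(_ _ e2) uR; move/cvgrPdist_lt : uI => /(_ _ e2) uI.
apply: filterS2 uR uI => i uR uI.
apply: (le_lt_trans (normc_le_ReIm _)); rewrite ltcR !raddfB/=.
by rewrite [ltRHS]splitr ltrD.
Qed.

Lemma uniform_cvg_complexP (T : choiceType) (u : nat -> T -> R[i]^o) (z : R[i]^o) :
    (forall e : R, 0 < e ->
      \forall k \near \oo, forall x, `|complex.Re (u k x) - complex.Re z| < e) ->
    (forall e : R, 0 < e ->
      \forall k \near \oo, forall x, `|complex.Im (u k x) - complex.Im z| < e) ->
  {uniform, u @ \oo --> (cst z : T -> R[i]^o)}.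
Proof.
move=> uR uI P /uniform_nbhs[E [entE EP]].
move: entE; rewrite -entourage_ballE => -[e0 /= /complex_eps[e e_gt0 ->] eE].
have e2 : 0 < e / 2 by rewrite divr_gt0.
apply: filterS2 (uR _ e2) (uI _ e2) => k kR kI.
apply: EP => x _; apply: eE => /=.
rewrite -ball_normE/=; apply: (le_lt_trans (normc_le_ReIm _)).
rewrite ltcR !raddfB/= [ltRHS]splitr.
by rewrite ltrD// distrC.
Qed.

End complex_topology.

Section Avg.
Context {R : realType} {X : ptopologicalType} {G : groupType}.
Variable U : G -> X -> X.

Lemma Re_Avg F (f : X -> R[i]^o) x :
  complex.Re (Avg U F f x) = ravg U F (@complex.Re R \o f) x.
Proof.
rewrite /Avg /ravg -(rmorph_nat (real_complex R)) -fmorphV.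
have -> (r : R) (z : R[i]) : complex.Re (r%:C * z) = r * complex.Re z.
  by case: z => a b; rewrite /= mul0r subr0.
by rewrite raddf_sum.
Qed.

Lemma Im_Avg F (f : X -> R[i]^o) x :
  complex.Im (Avg U F f x) = ravg U F (@complex.Im R \o f) x.
Proof.
rewrite /Avg /ravg -(rmorph_nat (real_complex R)) -fmorphV.
have -> (r : R) (z : R[i]) : complex.Im (r%:C * z) = r * complex.Im z.
  by case: z => a b; rewrite /= mul0r addr0.
by rewrite raddf_sum.
Qed.

Lemma continuous_ReIm (f : X -> R[i]^o) : continuous f ->
  continuous (@complex.Re R \o f) /\ continuous (@complex.Im R \o f).
Proof. by move=> cf; split=> x; have /cvg_complexP[] := cf x. Qed.

Lemma Avg_cvg_uniform_pointwise (F : nat -> {fset G})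
    (mu : probability (borel X) R) (f : X -> R[i]^o) :
  Avg_cvg_uniform U F mu f -> Avg_cvg_pointwise U F mu f.
Proof.
move=> unif x; have := @uniform_subset_cvg _ _ _ setT [set x] _ _ (subsetT _) unif.
by rewrite /Avg_cvg_uniform uniform_set1 => H; exact: H.
Qed.

Lemma Avg_cvg_pointwise_ravg (F : nat -> {fset G})
    (mu : probability (borel X) R) :
    (forall f : X -> R[i]^o, continuous f -> Avg_cvg_pointwise U F mu f) ->
  forall f : X -> R, continuous f ->
    forall x, ravg U (F k) f x @[k --> \oo] --> \int[mu]_x f x.
Proof.
move=> Fmu f cf x.
have cfC : continuous ((fun y => (f y)%:C) : X -> R[i]^o).
  by move=> y; apply/cvg_complexP; split=> /=; [exact: cf|exact: cvg_cst].
have /cvg_complexP[+ _] := Fmu _ cfC x.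
by under eq_fun do rewrite Re_Avg.
Qed.

End Avg.

Theorem theorem3p3 (R : realType) (X : ptopologicalType) (G : groupType)
    (U : G -> X -> X)
    (X_compact : compact [set: X]) (X_metrizable : metrizable R X)
    (G_countable : countable [set: G]) (G_amenable : amenable R G)
    (XGU : dynamical_system U) :
  [<-> (*i*) uniquely_ergodic R U;
       (*ii*) exists F : nat -> {fset G}, left_Folner R F /\
         exists mu : probability (borel X) R,
           forall f : X -> R[i]^o, continuous f -> Avg_cvg_uniform U F mu f;
       (*iii*) exists F : nat -> {fset G}, left_Folner R F /\
         exists mu : probability (borel X) R,
           forall f : X -> R[i]^o, continuous f -> Avg_cvg_pointwise U F mu f;
       (*iv*) exists mu : probability (borel X) R,
         forall F : nat -> {fset G}, right_Folner R F ->
         forall f : X -> R[i]^o, continuous f -> Avg_cvg_uniform U F mu f;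
       (*v*) exists mu : probability (borel X) R,
         forall F : nat -> {fset G}, right_Folner R F ->
         forall f : X -> R[i]^o, continuous f -> Avg_cvg_pointwise U F mu f].
Proof.
(* One sequence in two roles: as a left Folner sequence it witnesses (ii), as a right one it gives
   uniform convergence and the existence of an invariant measure. *)
have [F0 [F0l F0r]] := amenable_Folner G_countable G_amenable.
have i_uniform : uniquely_ergodic R U ->
    exists mu : probability (borel X) R,
      forall F : nat -> {fset G}, right_Folner R F ->
      forall f : X -> R[i]^o, continuous f -> Avg_cvg_uniform U F mu f.
  move=> [mu _ mu_unique]; exists mu => F FF f /continuous_ReIm[cR cI].
  apply: uniform_cvg_complexP => e e0.
    have := uniquely_ergodic_uniform X_compact X_metrizable XGU mu_unique FF cR e0.
    by apply: filterS => k + x => /(_ x); rewrite Re_Avg.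
  have := uniquely_ergodic_uniform X_compact X_metrizable XGU mu_unique FF cI e0.
  by apply: filterS => k + x => /(_ x); rewrite Im_Avg.
have pointwise_i F (mu : probability (borel X) R) : (forall k, F k != fset0) ->
    (forall f : X -> R[i]^o, continuous f -> Avg_cvg_pointwise U F mu f) ->
    uniquely_ergodic R U.
  move=> Fne /Avg_cvg_pointwise_ravg.
  exact: (pointwise_uniquely_ergodic X_compact X_metrizable XGU F0r).
tfae.
- move=> /i_uniform[mu muP]; exists F0; split=> //; exists mu; exact: muP.
- move=> [F [FF [mu muP]]]; exists F; split=> //; exists mu => f cf.
  exact/Avg_cvg_uniform_pointwise/muP.
(* The way from (iii) to (iv) goes back through (i). *)
- by move=> [F [[Fne _] [mu muP]]]; apply/i_uniform/(pointwise_i F mu).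
- move=> [mu muP]; exists mu => F FF f cf.
  exact/Avg_cvg_uniform_pointwise/muP.
- move=> [mu muP]; apply: (pointwise_i F0 mu); first by case: F0l.
  exact: muP.
Qed.
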